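(* Let $n\ge3$ and let $A_1A_2\ldots A_n$ be a bicentric convex polygon in the Euclidean plane, let $r_C$ be the radius of its incircle, let $M_1M_2\ldots M_n$ be the polygon formed by the centers of its excircles, where $M_i$ is the center of the excircle belonging to the side $A_iA_{i+1}$, and let $r_E$ be the radius of the circumcircle of $M_1M_2\ldots M_n$. Then $$\frac{\operatorname{area}(A_1A_2\ldots A_n)}{\operatorname{area}(M_1M_2\ldots M_n)}=\frac{r_C}{r_E}.$$
   Context: Indices are read cyclically modulo $n$. A convex polygon $A_1\ldots A_n$ is bicentric if all its vertices lie on a circle (its circumcircle) and there is a circle inside the polygon tangent to all its sides (its incircle). No two adjacent sides lie on the same line. The excircle belonging to the side $A_iA_{i+1}$ is the circle tangent to the side $A_iA_{i+1}$ and to the extensions of the two adjacent sides $A_{i-1}A_i$ and $A_{i+1}A_{i+2}$. Its center $M_i$ is the intersection point of the external angle bisectors at $A_i$ and $A_{i+1}$, where the external angle bisector at $A_j$ is the line through $A_j$ perpendicular to the line joining $A_j$ to the center of the incircle. For a bicentric polygon the points $M_1,\dots,M_n$ lie on a common circle; this is the circumcircle of $M_1M_2\ldots M_n$ referred to in the statement. *)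

(* Defs.v *)
From HB Require Import structures.
From mathcomp Require Import all_boot all_order all_algebra.
From mathcomp Require Import all_classical all_reals all_analysis.

Set Implicit Arguments.
Unset Strict Implicit.
Unset Printing Implicit Defensive.

Import Order.TTheory GRing.Theory Num.Theory.
Import numFieldNormedType.Exports.

Local Open Scope classical_set_scope.
Local Open Scope ring_scope.

(* The plane is R * R. Its library norm is the max norm, which is only used
   below through its topology and its bounded sets; Euclidean lengths are
   always [edist]. A polygon is the map of its vertices, and [ordS] is the
   successor of indices modulo n. *)

Section Plane.
Context {R : realType}.
Implicit Types P Q X C : R * R.

Definition edist P Q : R := Num.sqrt ((P.1 - Q.1) ^+ 2 + (P.2 - Q.2) ^+ 2).

Definition circle C (r : R) : set (R * R) := [set P | edist C P = r].

Definition line P Q : set (R * R) := [set P + t *: (Q - P) | t in [set: R]].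

Definition segment P Q : set (R * R) :=
  [set P + t *: (Q - P) | t in `[0, 1]%classic].

(* The extension of the segment PQ beyond Q. *)
Definition extension P Q : set (R * R) :=
  [set P + t *: (Q - P) | t in `[1, +oo[%classic].

(* Twice the signed area of the triangle PQX: its sign tells on which side
   of the line PQ the point X lies. *)
Definition orient P Q X : R :=
  (Q.1 - P.1) * (X.2 - P.2) - (Q.2 - P.2) * (X.1 - P.1).

(* The circle is tangent to the line PQ at a point of the part S of it. *)
Definition tangent_at_part C r P Q (S : set (R * R)) : Prop :=
  exists2 T, S T & circle C r `&` line P Q = [set T].

Definition tangent_to_segment C r P Q := tangent_at_part C r P Q (segment P Q).

Definition tangent_to_extension C r P Q :=
  tangent_at_part C r P Q (extension P Q).

End Plane.

Section Polygon.
Context {R : realType} {n : nat}.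
Implicit Types A M : 'I_n -> R * R.

Definition sides A : set (R * R) :=
  \bigcup_(i in [set: 'I_n]) segment (A i) (A (ordS i)).

(* The closed region enclosed by the polygon: the sides, together with the
   points lying in a bounded component of the complement of the sides. *)
Definition region A : set (R * R) :=
  sides A `|` [set P | ~ sides A P /\
    bounded_set (connected_component (~` sides A) P)].

Definition area A : R :=
  fine ((@lebesgue_measure R \x @lebesgue_measure R)%E (region A)).

(* The condition on half-planes alone would allow a polygon traversed several
   times; together with the distinctness of the vertices and the fact that
   adjacent sides are not collinear, it forces the polygon to be simple. Both
   orientations are allowed. *)
Definition convex_polygon A : Prop :=
  [/\ injective A,
      forall i, ~ line (A i) (A (ordS i)) (A (ordS (ordS i)))
    & forall i, (forall k, 0 <= orient (A i) (A (ordS i)) (A k)) \/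
                (forall k, orient (A i) (A (ordS i)) (A k) <= 0)].

Definition circumcircle A (C : R * R) (r : R) : Prop :=
  0 < r /\ forall i, circle C r (A i).

Definition incircle A (C : R * R) (r : R) : Prop :=
  [/\ 0 < r, circle C r `<=` region A
    & forall i, tangent_to_segment C r (A i) (A (ordS i))].

(* [A] is meant to be convex. The adjacent sides are extended beyond [A i] and
   beyond [A (ordS i)]. *)
Definition excircle A (i : 'I_n) (C : R * R) (r : R) : Prop :=
  [/\ 0 < r,
      tangent_to_segment C r (A i) (A (ordS i)),
      tangent_to_extension C r (A (ord_pred i)) (A i)
    & tangent_to_extension C r (A (ordS (ordS i))) (A (ordS i))].

Definition excenter A (i : 'I_n) (C : R * R) : Prop :=
  exists r, excircle A i C r.

Definition bicentric A : Prop :=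
  [/\ convex_polygon A,
      exists C, exists r, circumcircle A C r
    & exists C, exists r, incircle A C r].

End Polygon.

(* Main.v *)
(* Let I be the incenter, u_i the outward unit normal of the side A_i A_{i+1},
   and let O and R be the circumcenter and circumradius of A. Writing x_i and
   y_i for the two tangent lengths of that side, the excircle touches it at
   distance y_i from A_i and has radius x_i y_i / rC. Together with the power of
   the contact point with respect to the circumcircle, this gives
     M_i = (2 O - I) + k u_i  with  k = (R^2 - |OI|^2) / rC,
   so M is a homothetic image of the contact polygon, its circumcenter is
   2 O - I, and rE = k.
   Then area A = rC * p / 2 with p = sum (x_i + y_i) the perimeter of A, and the
   triangle on M_i M_{i+1} with apex 2 O - I has area k (x_i + y_{i+1}) / 2, so
   that area M = k * p / 2.
   The area of a convex polygon is computed by cutting it into triangles from an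
   interior point C: for the affine functions g_j that vanish on the side j and
   are 1 at C, the polygon is where all g_j are nonnegative, and the triangle on
   the side i is the part of it where g_i is the smallest of them. *)

Require Import Defs.
From HB Require Import structures.
From mathcomp Require Import all_boot all_order all_algebra.
From mathcomp Require Import all_classical all_reals all_analysis.
From mathcomp Require Import unstable measurable_realfun ring lra.
Set Implicit Arguments.
Unset Strict Implicit.
Unset Printing Implicit Defensive.
Import Order.TTheory GRing.Theory Num.Theory.
Import numFieldNormedType.Exports.
Local Open Scope classical_set_scope.
Local Open Scope ring_scope.

(** * Planar Lebesgue measure *)

Section AffineMeasure.
Context {R : realType}.
Local Notation mu := (@lebesgue_measure R).
Local Notation mu2 := (mu \x mu)%E.
Local Notation R2 := (measurableTypeR R * measurableTypeR R)%type.

Definition affine1 (b e : R) (y : measurableTypeR R) : measurableTypeR R :=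
  b * y + e.

Lemma measurable_affine1 b e : measurable_fun setT (affine1 b e).
Proof. by apply: measurable_funD => //; exact: measurable_funM. Qed.

Lemma preimage_affine1_itv (b e x y : R) : b != 0 ->
  affine1 b e @^-1` `]x, y] =
    if 0 < b then `]((x - e) / b), ((y - e) / b)]%classic
    else `[((y - e) / b), ((x - e) / b)[%classic.
Proof.
move=> b0; apply/seteqP; split=> z /=; rewrite /affine1 in_itv/=.
  case: ifPn => [b_gt0|]; rewrite /= in_itv/=.
    by rewrite ltr_pdivrMr// ler_pdivlMr// mulrC lerBrDr ltrBlDr.
  move=> nb; have b_lt0 : b < 0 by rewrite lt_neqAle b0 leNgt.
  rewrite ler_ndivrMr// ltr_ndivlMr// mulrC lerBrDr ltrBlDr andbC.
  by move=> /andP[-> ->].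
case: ifPn => [b_gt0|]; rewrite /= in_itv/=.
  by rewrite ltr_pdivrMr// ler_pdivlMr// mulrC lerBrDr ltrBlDr.
move=> nb; have b_lt0 : b < 0 by rewrite lt_neqAle b0 leNgt.
by rewrite ler_ndivrMr// ltr_ndivlMr// mulrC lerBrDr ltrBlDr andbC.
Qed.

(** The pushforward of [mu] by the map, scaled by the absolute value of [b], agrees with [mu] on
    half-open intervals, hence everywhere by uniqueness of Lebesgue measure. *)
Lemma lebesgue_measure_affine (b e : R) (A : set (measurableTypeR R)) : b != 0 ->
  measurable A -> mu (affine1 b e @^-1` A) = (`|b|^-1%:E * mu A)%E.
Proof.
move=> b0 mA.
pose push : {measure set (measurableTypeR R) -> \bar R} :=
  measure_function_pushforward__canonical__measure_function_Measure mu
    (measurable_affine1 b e).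
pose nu : {measure set (measurableTypeR R) -> \bar R} :=
  mscale (NngNum (normr_ge0 b)) push.
suff -> : mu A = nu A.
  rewrite /nu /mscale/= muleA -EFinM mulVf ?mul1e//.
  by rewrite normr_eq0.
apply: lebesgue_measure_unique => // _ [[x y] _ <-].
have -> : nu `]x, y]%classic = (`|b|%:E * mu (affine1 b e @^-1` `]x, y]))%E by [].
rewrite preimage_affine1_itv//.
rewrite lebesgue_measure_itv/= lte_fin.
have [b_gt0|b_le0] := ltP 0 b.
  rewrite lebesgue_measure_itv/= lte_fin ltr_pM2r ?invr_gt0// ltrD2r.
  case: ifPn => _; last by rewrite mule0.
  rewrite -!EFinB -EFinM gtr0_norm//; congr _%:E; field.
  exact: b0.
have b_lt0 : b < 0 by rewrite lt_neqAle b0.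
rewrite lebesgue_measure_itv/= lte_fin ltr_nM2r ?invr_lt0// ltrD2r.
case: ifPn => _; last by rewrite mule0.
rewrite -!EFinB -EFinM ltr0_norm//; congr _%:E; field.
exact: b0.
Qed.

Definition shear2 (a b e : R) (P : R2) : R2 := (P.1, b * P.2 + (a * P.1 + e)).

Lemma measurable_shear2 a b e : measurable_fun setT (shear2 a b e).
Proof.
apply: measurable_fun_pair; first exact: measurable_fst.
apply: measurable_funD => //; first exact: measurable_funM.
by apply: measurable_funD => //; exact: measurable_funM.
Qed.

(** By Fubini: over a fixed first coordinate, the section of the preimage is the preimage of the
    section of [A] under a one-variable affine map of slope [b]. *)
Lemma measure_shear2 (a b e : R) (A : set R2) : b != 0 -> measurable A ->
  mu2 (shear2 a b e @^-1` A) = (`|b|^-1%:E * mu2 A)%E.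
Proof.
move=> b0 mA.
rewrite /product_measure1 -ge0_integralZl//; last exact: measurable_fun_xsection.
apply: eq_integral => x _ /=.
rewrite -(@lebesgue_measure_affine b (a * x + e))//; last exact: measurable_xsection.
Qed.

Lemma measure_swap (A : set R2) : measurable A ->
  mu2 (@swap R R @^-1` A) = mu2 A.
Proof.
move=> mA.
pose m : {measure set (measurableTypeR R * measurableTypeR R) -> \bar R} :=
  measure_function_pushforward__canonical__measure_function_Measure mu2
    (@measurable_swap _ _ _ _).
apply/esym/(@product_measure_unique _ _ _ _ _ _ _ m) => //.
move=> X Y mX mY.
have -> : m (X `*` Y) = mu2 (Y `*` X).
  by congr (mu2 _); apply/seteqP; split=> -[x y] /= [].
by rewrite [LHS]product_measure1E// muleC.
Qed.

Definition affine2 (s1 s2 s0 t1 t2 t0 : R) (P : R2) : R2 :=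
  (s1 * P.1 + s2 * P.2 + s0, t1 * P.1 + t2 * P.2 + t0).

Lemma measurable_linear_form (a b c : R) :
  measurable_fun setT (fun P : R2 => a * P.1 + b * P.2 + c).
Proof.
apply: measurable_funD => //.
by apply: measurable_funD; exact: measurable_funM.
Qed.

Lemma measurable_affine2 s1 s2 s0 t1 t2 t0 :
  measurable_fun setT (affine2 s1 s2 s0 t1 t2 t0).
Proof. by apply: measurable_fun_pair; exact: measurable_linear_form. Qed.

(** Gaussian elimination: with a nonzero pivot [s1] the map is a shear in the first coordinate
    followed by one in the second, with factors [s1] and [D / s1]. A zero pivot is removed by
    exchanging the two rows, which only changes the sign of the determinant. *)
Lemma measure_affine2 s1 s2 s0 t1 t2 t0 (A : set R2) :
  s1 * t2 - s2 * t1 != 0 -> measurable A ->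
  mu2 (affine2 s1 s2 s0 t1 t2 t0 @^-1` A) =
  (`|s1 * t2 - s2 * t1|^-1%:E * mu2 A)%E.
Proof.
wlog s1N0 : s1 s2 s0 t1 t2 t0 A / s1 != 0 => [wlog_s1|D0 mA].
  have [s1_0 D0 mA|s1_0] := eqVneq s1 0; last exact: wlog_s1.
  have t1_0 : t1 != 0.
    by apply: contraNneq D0 => ->; rewrite s1_0 mul0r mulr0 subrr.
  have msA : measurable (@swap R R @^-1` A).
    by rewrite -[X in measurable X]setTI; exact: measurable_swap.
  have -> : affine2 s1 s2 s0 t1 t2 t0 @^-1` A =
            affine2 t1 t2 t0 s1 s2 s0 @^-1` (@swap R R @^-1` A) by [].
  have D0' : t1 * s2 - t2 * s1 != 0 by rewrite -oppr_eq0 opprB mulrC [t1 * _]mulrC.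
  rewrite wlog_s1//.
  by rewrite measure_swap// -normrN opprB [t2 * _]mulrC [t1 * _]mulrC.
pose D := s1 * t2 - s2 * t1.
have mB : measurable (shear2 (t1 / s1) (D / s1) (t0 - t1 * s0 / s1) @^-1` A).
  by rewrite -[X in measurable X]setTI; exact: measurable_shear2.
set B := shear2 _ _ _ @^-1` A in mB.
have msB : measurable (@swap R R @^-1` B).
  by rewrite -[X in measurable X]setTI; exact: measurable_swap.
have -> : affine2 s1 s2 s0 t1 t2 t0 @^-1` A =
    @swap R R @^-1` (shear2 s2 s1 s0 @^-1` (@swap R R @^-1` B)).
  apply/seteqP; split=> -[x y]; rewrite /B /affine2 /shear2 /D/=;
    by congr (A (_, _)); field.
rewrite measure_swap; last first.
  by rewrite -[X in measurable X]setTI; exact: measurable_shear2.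
rewrite measure_shear2// measure_swap// /B measure_shear2//; last first.
  by rewrite mulf_neq0// invr_eq0.
rewrite muleA -EFinM -invfM -normrM; congr (_^-1%:E * _)%E.
by rewrite mulrC divfK.
Qed.

(** Completing the form by the row [(- b, a)] gives the determinant [a ^+ 2 + b ^+ 2], so the line
    is the preimage of the vertical axis, a null set, under an invertible affine map. *)
Lemma measure_line (a b c : R) : (a != 0) || (b != 0) ->
  mu2 [set P | a * P.1 + b * P.2 + c = 0] = 0%E.
Proof.
move=> ab0.
have -> : [set P | a * P.1 + b * P.2 + c = 0] =
    affine2 a b c (- b) a 0 @^-1` ([set 0] `*` [set: R]).
  by apply/seteqP; split => [P|P []].
rewrite measure_affine2.
- have -> : mu2 ([set 0] `*` [set: R]) = 0%E; last by rewrite mule0.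
  rewrite product_measure1E//.
  by have /= -> := lebesgue_measure_set1 (0 : R); rewrite mul0e.
- rewrite mulrN opprK -!expr2 paddr_eq0 ?sqr_ge0// !sqrf_eq0.
  by rewrite negb_and.
- by apply: measurableX => //; exact: measurable_set1.
Qed.

Lemma measurable_halfplane (a b c : R) :
  measurable [set P : R2 | a * P.1 + b * P.2 + c <= 0].
Proof.
have -> : [set P : R2 | a * P.1 + b * P.2 + c <= 0] =
    (fun P : R2 => a * P.1 + b * P.2 + c) @^-1` `]-oo, 0].
  by apply/seteqP; split=> P /=; rewrite in_itv.
by rewrite -[X in measurable X]setTI; exact: measurable_linear_form.
Qed.

Lemma measurable_line (a b c : R) :
  measurable [set P : R2 | a * P.1 + b * P.2 + c = 0].
Proof.
have -> : [set P : R2 | a * P.1 + b * P.2 + c = 0] =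
    [set P : R2 | a * P.1 + b * P.2 + c <= 0] `&`
    [set P : R2 | (- a) * P.1 + (- b) * P.2 + (- c) <= 0].
  by apply/seteqP; split=> P /=; [split|case]; lra.
by apply: measurableI; exact: measurable_halfplane.
Qed.

Definition simplex2 : set R2 := [set P | [/\ 0 <= P.1, 0 <= P.2 & P.1 + P.2 <= 1]].

Lemma measurable_simplex2 : measurable simplex2.
Proof.
have -> : simplex2 = [set P | (-1) * P.1 + 0 * P.2 + 0 <= 0] `&`
    [set P | 0 * P.1 + (-1) * P.2 + 0 <= 0] `&` [set P | 1 * P.1 + 1 * P.2 + (-1) <= 0].
  by apply/seteqP; split=> P /=; [case=> *; split; first split; lra|
    case=> -[*]; split; lra].
by do 2?apply: measurableI; exact: measurable_halfplane.
Qed.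

(** * Unions with null overlaps, and the area of the standard triangle *)

Lemma measure_setU_null d (T : measurableType d) (m : {measure set T -> \bar R})
    (A B : set T) : measurable A -> measurable B -> m (A `&` B) = 0%E ->
  m (A `|` B) = (m A + m B)%E.
Proof.
move=> mA mB AB0.
have -> : A `|` B = A `|` (B `\` A).
  apply/seteqP; split=> x /=; last by move=> [|[]]; [left|right].
  by have [Ax|nAx] := pselect (A x); [left|case=> //; right].
rewrite measureU//.
- rewrite [in RHS](measureDI m mB mA) [X in _ = (_ + (_ + X))%E](_ : _ = 0%E) ?adde0//.
  by rewrite setIC.
- exact: measurableD.
- by apply/seteqP; split=> x //= [Ax [_ /(_ Ax)]].
Qed.

Lemma bigcup_ord_recr T (n : nat) (F : 'I_n.+1 -> set T) :
  \bigcup_(i in [set: 'I_n.+1]) F i =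
  \bigcup_(i in [set: 'I_n]) F (widen_ord (leqnSn n) i) `|` F ord_max.
Proof.
apply/seteqP; split=> x.
  move=> [i _]; case: (unliftP ord_max i) => [j ->|-> Fx]; last by right.
  move=> Fx; left; exists j => //; congr (F _ x): Fx; apply/val_inj => /=.
  by rewrite /bump leqNgt ltn_ord add0n.
by case=> [[i _ Fx]|Fx]; [exists (widen_ord (leqnSn n) i)|exists ord_max].
Qed.

Lemma measure_bigcup_null0 d (T : measurableType d) (m : {measure set T -> \bar R})
    (n : nat) (F : 'I_n -> set T) : (forall i, measurable (F i)) ->
  (forall i, m (F i) = 0%E) -> m (\bigcup_(i in [set: 'I_n]) F i) = 0%E.
Proof.
elim: n F => [|n IHn] F mF F0.
  by rewrite (_ : \bigcup_(i in _) _ = set0) ?measure0//; apply/seteqP; split=> // x [[]].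
by rewrite bigcup_ord_recr null_set_setU ?IHn//; apply: fin_bigcup_measurable.
Qed.

Lemma measure_bigcup_null d (T : measurableType d) (m : {measure set T -> \bar R})
    (n : nat) (F : 'I_n -> set T) : (forall i, measurable (F i)) ->
  (forall i j, i != j -> m (F i `&` F j) = 0%E) ->
  m (\bigcup_(i in [set: 'I_n]) F i) = (\sum_(i < n) m (F i))%E.
Proof.
elim: n F => [|n IHn] F mF F0.
  rewrite big_ord0 (_ : \bigcup_(i in _) _ = set0) ?measure0//.
  by apply/seteqP; split=> // x [[]].
rewrite bigcup_ord_recr measure_setU_null//.
- rewrite big_ord_recr/= IHn// => i j ij; apply: F0.
  by apply: contra ij => /eqP/(congr1 val)/= /val_inj ->.
- by apply: fin_bigcup_measurable.
- rewrite setI_bigcupl measure_bigcup_null0// => i; first exact: measurableI.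
  by apply: F0; apply/eqP => /(congr1 val)/= e; have := ltn_ord i; rewrite e ltnn.
Qed.

(** The half-turn [L] about the centre of the unit square preserves area; the square is the union of
    the triangle and its image, which meet only on a diagonal. *)
Lemma measure_simplex2 : mu2 simplex2 = (2^-1)%:E.
Proof.
pose L := affine2 (-1) 0 1 0 (-1) 1.
have mL : measurable (L @^-1` simplex2).
  rewrite -[X in measurable X]setTI; apply: measurable_affine2 => //.
  exact: measurable_simplex2.
have mS := measurable_simplex2.
have LS : mu2 (L @^-1` simplex2) = mu2 simplex2.
  have D1 : (-1) * (-1) - 0 * 0 = 1 :> R by lra.
  by rewrite measure_affine2// D1 ?oner_eq0// normr1 invr1 mul1e.
have : mu2 (`[0, 1]%classic `*` `[0, 1]%classic : set R2) = 1%E.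
  rewrite product_measure1E//; try exact: measurable_itv.
  by have /= -> := lebesgue_measure_itv `[0%R, 1%R : R]; rewrite /= lte01 oppr0 adde0 mule1.
have -> : `[0, 1]%classic `*` `[0, 1]%classic = simplex2 `|` (L @^-1` simplex2).
  apply/seteqP; split=> -[x y]; rewrite /simplex2 /L /affine2/= !in_itv/=.
    move=> [/andP[x0 x1] /andP[y0 y1]]; have [xy|xy] := leP (x + y) 1.
      by left.
    by right; split; lra.
  by move=> [] [*]; split; apply/andP; split; lra.
have -> : mu2 (simplex2 `|` L @^-1` simplex2) = (mu2 simplex2 + mu2 simplex2)%E.
  rewrite -[X in (_ = _ + X)%E]LS; apply: measure_setU_null => //.
  apply: subset_measure0 (@measure_line 1 1 (-1) _); last by rewrite oner_eq0.
  - exact: measurableI.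
  - exact: measurable_line.
  - by move=> P [[/= ? ? ?] []]; rewrite /L /affine2/= => ? ? ?; lra.
case: (mu2 simplex2) => [r|//|//].
by move=> [] e; congr _%:E; lra.
Qed.

End AffineMeasure.

(** * Convex polygons *)

Section ConvexPolygon.
Context {R : realType}.
Local Notation mu2 := ((@lebesgue_measure R) \x (@lebesgue_measure R))%E.
Local Notation R2 := (measurableTypeR R * measurableTypeR R)%type.

(** Reduces a vector identity to one scalar identity per coordinate, ready for [ring] or [field]. *)
Lemma pairE : (forall P Q : R * R, (P + Q).1 = P.1 + Q.1) *
  (forall P Q : R * R, (P + Q).2 = P.2 + Q.2) *
  (forall P : R * R, (- P).1 = - P.1) * (forall P : R * R, (- P).2 = - P.2) *
  (forall (t : R) (P : R * R), (t *: P).1 = t * P.1) *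
  (forall (t : R) (P : R * R), (t *: P).2 = t * P.2).
Proof. by []. Qed.

Lemma orient_rot (P Q X : R * R) : orient P Q X = orient Q X P.
Proof. by rewrite /orient; ring. Qed.

Lemma orient_lin (P Q X : R * R) : orient P Q X =
  (P.2 - Q.2) * X.1 + (Q.1 - P.1) * X.2 + (P.1 * Q.2 - Q.1 * P.2).
Proof. by rewrite /orient; ring. Qed.

Lemma orient_comb (P Q C U V : R * R) s t :
  orient P Q (C + s *: (U - C) + t *: (V - C)) =
  (1 - s - t) * orient P Q C + s * orient P Q U + t * orient P Q V.
Proof. by rewrite /orient !pairE; ring. Qed.

Lemma orient_left (P Q : R * R) : orient P Q P = 0.
Proof. by rewrite /orient; ring. Qed.

Lemma orient_right (P Q : R * R) : orient P Q Q = 0.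
Proof. by rewrite /orient; ring. Qed.

Lemma orient_neq0 (P Q X : R * R) : P != Q -> ~ line P Q X -> orient P Q X != 0.
Proof.
move=> PQ nl; apply/eqP; rewrite /orient => o0; apply: nl.
have [PQ1|PQ1] := eqVneq (Q.1 - P.1) 0; last first.
  exists ((X.1 - P.1) / (Q.1 - P.1)) => //.
  rewrite [X in _ = X]surjective_pairing; congr (_, _); rewrite !pairE; first by field.
  apply: (mulfI PQ1); apply/eqP; rewrite -subr_eq0; apply/eqP.
  by rewrite -oppr0 -o0; field.
have PQ2 : Q.2 - P.2 != 0.
  apply: contra PQ => /eqP PQ2; apply/eqP.
  rewrite [P]surjective_pairing [Q]surjective_pairing; congr (_, _); lra.
exists ((X.2 - P.2) / (Q.2 - P.2)) => //.
rewrite [X in _ = X]surjective_pairing; congr (_, _); rewrite !pairE; last by field.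
move: o0; rewrite PQ1 mul0r sub0r mulr0 addr0 => /eqP.
by rewrite oppr_eq0 mulf_eq0 (negbTE PQ2)/= => /eqP; lra.
Qed.

(* The coordinates of [X - C] in the basis [P - C], [Q - C]. *)
Definition baryl (C P Q X : R * R) : R := orient C X Q / orient C P Q.
Definition baryr (C P Q X : R * R) : R := orient C P X / orient C P Q.

(** Cramer's rule. *)
Lemma baryE (C P Q X : R * R) : orient C P Q != 0 ->
  X = C + baryl C P Q X *: (P - C) + baryr C P Q X *: (Q - C).
Proof.
rewrite /baryl /baryr /orient => D0.
by rewrite [X in X = _]surjective_pairing; congr (_, _); rewrite ?pairE/=; field.
Qed.

(** Defined by coordinates, so that it is an affine preimage of [simplex2]. If [orient C P Q] is 0,
    both coordinates take the default value 0 and the set is the whole plane. *)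
Definition triangle (C P Q : R * R) : set R2 :=
  [set X | [/\ 0 <= baryl C P Q X, 0 <= baryr C P Q X &
               baryl C P Q X + baryr C P Q X <= 1]].

Lemma triangle_affine (C P Q : R * R) : triangle C P Q =
  affine2 ((Q.2 - C.2) / orient C P Q) ((C.1 - Q.1) / orient C P Q)
          ((C.2 * Q.1 - C.1 * Q.2) / orient C P Q)
          ((C.2 - P.2) / orient C P Q) ((P.1 - C.1) / orient C P Q)
          ((C.1 * P.2 - C.2 * P.1) / orient C P Q) @^-1` simplex2.
Proof.
apply/seteqP; split=> X; rewrite /triangle /simplex2 /affine2 /baryl /baryr/=;
  by (have -> : orient C X Q = (Q.2 - C.2) * X.1 + (C.1 - Q.1) * X.2 +
        (C.2 * Q.1 - C.1 * Q.2) by rewrite /orient; ring);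
     (have -> : orient C P X = (C.2 - P.2) * X.1 + (P.1 - C.1) * X.2 +
        (C.1 * P.2 - C.2 * P.1) by rewrite /orient; ring);
     rewrite !mulrDl ![_ * X.1 / _]mulrAC ![_ * X.2 / _]mulrAC.
Qed.

Lemma measurable_triangle (C P Q : R * R) : measurable (triangle C P Q).
Proof.
rewrite triangle_affine -[X in measurable X]setTI; apply: measurable_affine2 => //.
exact: measurable_simplex2.
Qed.

(** The map to the coordinates has determinant [D^-1], so areas in the plane are those of the
    standard triangle times the absolute value of [D]. *)
Lemma measure_triangle (C P Q : R * R) : orient C P Q != 0 ->
  mu2 (triangle C P Q) = (`|orient C P Q| / 2)%:E.
Proof.
move=> D0; set D := orient C P Q.
have det : (Q.2 - C.2) / D * ((P.1 - C.1) / D) -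
    (C.1 - Q.1) / D * ((C.2 - P.2) / D) = D^-1.
  by move: D0; rewrite /D /orient => D0; field.
rewrite triangle_affine measure_affine2; last exact: measurable_simplex2.
  by rewrite det measure_simplex2 -EFinM normfV invrK.
by rewrite det invr_eq0.
Qed.

(** * Cyclic indices and the orientation of a convex polygon *)

Lemma ordS_neq n (i : 'I_n) : (1 < n)%N -> ordS i != i.
Proof.
move=> n1; apply/eqP => /(congr1 val)/=.
have [lt|] := ltnP i.+1 n; first by rewrite modn_small// => /eqP; rewrite eqn_leq ltnn.
move=> ge; have -> : i.+1 = n by apply/eqP; rewrite eqn_leq ge ltn_ord.
by rewrite modnn => i0; move: ge n1; rewrite -i0; case: n {i i0} => [//|[]].
Qed.

Lemma ordS_ind n (P : 'I_n -> Prop) : (forall i, P i -> P (ordS i)) ->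
  forall i, P i -> forall j, P j.
Proof.
move=> PS i Pi.
have n0 : (0 < n)%N by apply: leq_ltn_trans (ltn_ord i).
have Piter k : P (iter k (@ordS n) i) by elim: k => //= k; exact: PS.
have iterE k : iter k (@ordS n) i = ((i + k) %% n)%N :> nat.
  elim: k => [|k IHk]; first by rewrite addn0 modn_small.
  by rewrite iterS /= IHk addnS -[(i + k).+1]addn1 -[((i + k) %% n).+1]addn1 modnDml.
(* This many successors lead from [i] to [j]; the summand [n] keeps the natural subtraction from
   being truncated. *)
move=> j; have := Piter (j + n - i)%N.
congr P; apply/val_inj; rewrite /= iterE subnKC; first by rewrite modnDr modn_small.
by apply: leq_trans (leq_addl _ _); exact: ltnW.
Qed.

(* [sg] is 1 when the vertices turn counterclockwise and -1 otherwise. *)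
Definition oriented_polygon n (A : 'I_n -> R * R) (sg : R) : Prop :=
  [/\ injective A,
      sg = 1 \/ sg = - 1,
      forall j k, 0 <= sg * orient (A j) (A (ordS j)) (A k)
    & forall j, 0 < sg * orient (A j) (A (ordS j)) (A (ordS (ordS j)))].

(** The sign of one corner fixes [sg]. It passes from the corner of side [j] to the next one because
    [A j] and [A (ordS (ordS (ordS j)))] lie on the same side of the line of side [ordS j], and no
    corner is degenerate. *)
Lemma convex_oriented n (A : 'I_n -> R * R) : (3 <= n)%N ->
  convex_polygon A -> exists sg, oriented_polygon A sg.
Proof.
move=> n3 [injA nl hp].
have n1 : (1 < n)%N by exact: ltnW.
have o0 i : orient (A i) (A (ordS i)) (A (ordS (ordS i))) != 0.
  by apply: orient_neq0 (nl i); apply: contraNneq (ordS_neq i n1) => /injA <-.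
pose i0 := Ordinal (ltnW n1).
have [sg sg1 sg0] : exists2 sg : R, sg = 1 \/ sg = - 1 &
    0 < sg * orient (A i0) (A (ordS i0)) (A (ordS (ordS i0))).
  have [lt|ge] := ltP 0 (orient (A i0) (A (ordS i0)) (A (ordS (ordS i0)))).
    by exists 1; [left|rewrite mul1r].
  exists (-1); first by right.
  by rewrite mulN1r oppr_gt0 lt_neqAle o0.
have sgP : forall j, 0 < sg * orient (A j) (A (ordS j)) (A (ordS (ordS j))).
  apply: (@ordS_ind n _ _ i0 sg0) => j sgj.
  have := o0 (ordS j); have := hp (ordS j); have := orient_rot (A j) (A (ordS j)) (A (ordS (ordS j))).
  move: sgj; case: sg1 => ->; rewrite ?mul1r ?mulN1r ?oppr_gt0 => sgj e [] h oN0;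
    have := h j; have := h (ordS (ordS (ordS j))); rewrite -?e ?lt_neqAle ?oN0 1?eq_sym ?oN0//=; lra.
exists sg; split => // j k.
have := sgP j.
by case: sg1 => ->; rewrite ?mul1r ?mulN1r ?oppr_gt0 ?oppr_ge0 => sj;
  case: (hp j) => h //; have := h (ordS (ordS j)); lra.
Qed.

(** * Half-planes bounding an oriented polygon *)

Section Oriented.
Context (n : nat) (A : 'I_n -> R * R) (sg : R).
Hypothesis oA : oriented_polygon A sg.

(** Up to the length of the side, this is the signed distance to its line, positive on the inner
    side. *)
Definition edge_height (j : 'I_n) (X : R * R) := sg * orient (A j) (A (ordS j)) X.
Local Notation h := edge_height.

Definition halfplanes : set R2 := [set X | forall j, 0 <= h j X].

Lemma edge_height_comb j C U V s t : h j (C + s *: (U - C) + t *: (V - C)) =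
  (1 - s - t) * h j C + s * h j U + t * h j V.
Proof. by rewrite /h orient_comb; ring. Qed.

Lemma edge_height_seg j P Q t :
  h j (P + t *: (Q - P)) = (1 - t) * h j P + t * h j Q.
Proof.
have := edge_height_comb j P P Q 0 t.
by rewrite scale0r addr0 => ->; ring.
Qed.

Lemma edge_height_left j : h j (A j) = 0.
Proof. by rewrite /h orient_left mulr0. Qed.

Lemma edge_height_right j : h j (A (ordS j)) = 0.
Proof. by rewrite /h orient_right mulr0. Qed.

Lemma edge_height_ge0 j k : 0 <= h j (A k).
Proof. by case: oA => _ _ H _; exact: H. Qed.

Lemma edge_height_next j : 0 < h j (A (ordS (ordS j))).
Proof. by case: oA => _ _ _; exact. Qed.

Lemma edge_height_prev j : 0 < h (ordS j) (A j).
Proof. by rewrite /h -orient_rot; case: oA => _ _ _; exact. Qed.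

Lemma halfplanes_seg P Q t : halfplanes P -> halfplanes Q -> 0 <= t <= 1 ->
  halfplanes (P + t *: (Q - P)).
Proof.
move=> KP KQ /andP[t0 t1] j; rewrite edge_height_seg.
by rewrite addr_ge0// mulr_ge0// subr_ge0.
Qed.

Lemma sides_halfplanes : sides A `<=` halfplanes.
Proof.
move=> X [i _] [t /=]; rewrite in_itv/= => t01 <-.
by apply: halfplanes_seg => // j; exact: edge_height_ge0.
Qed.

(** * The fan of triangles from an interior point, and the enclosed region *)

Section InteriorPoint.
Variable C : R * R.
Hypothesis hC : forall j, 0 < h j C.

Let orientC_neq0 j : orient C (A j) (A (ordS j)) != 0.
Proof.
rewrite orient_rot; apply: contraTN (hC j) => /eqP o0.
by rewrite /h o0 mulr0 ltxx.
Qed.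

(** The normalization makes all these affine functions equal to 1 at [C], so they can be compared
    with one another. *)
Definition reldist j X := h j X / h j C.
Local Notation g := reldist.

Lemma reldist_comb j U V s t : g j (C + s *: (U - C) + t *: (V - C)) =
  1 - s - t + s * g j U + t * g j V.
Proof.
rewrite /g edge_height_comb; have := hC j => hj.
by field; rewrite gt_eqF.
Qed.

(** If [s] and [t] are the coordinates of [X], then [g j X - g i X = s * g j (A i) + t * g j (A
    (ordS i))], which settles one direction. Conversely, the next side isolates the term in [s] and
    the previous side the term in [t], each with a positive coefficient. *)
Lemma triangle_reldist i X : triangle C (A i) (A (ordS i)) X <->
  0 <= g i X /\ forall j, g i X <= g j X.
Proof.
rewrite /triangle/=; have := baryE X (orientC_neq0 i).
move: (baryl _ _ _ _) (baryr _ _ _ _) => s t ->.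
have gl j : g j (A j) = 0 by rewrite /g edge_height_left mul0r.
have gr j : g j (A (ordS j)) = 0 by rewrite /g edge_height_right mul0r.
have gge0 j k : 0 <= g j (A k).
  by rewrite divr_ge0 ?edge_height_ge0// ltW.
have gi : g i (C + s *: (A i - C) + t *: (A (ordS i) - C)) = 1 - s - t.
  by rewrite reldist_comb gl gr !mulr0 !addr0.
rewrite gi; split=> [[s0 t0 st1]|[st1 gj]].
  split; first lra.
  move=> j; rewrite reldist_comb.
  have := mulr_ge0 s0 (gge0 j i); have := mulr_ge0 t0 (gge0 j (ordS i)); lra.
split; last lra.
- have := gj (ordS i); rewrite reldist_comb gl mulr0 addr0 => gt.
  rewrite -(@pmulr_lge0 _ (g (ordS i) (A i))); first lra.
  by rewrite divr_gt0// edge_height_prev.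
- have e : ordS (ord_pred i) = i by exact: ord_predK.
  have gp : g (ord_pred i) (A i) = 0 by rewrite -[in A i]e gr.
  have := gj (ord_pred i); rewrite reldist_comb gp mulr0 addr0 => gt.
  rewrite -(@pmulr_lge0 _ (g (ord_pred i) (A (ordS i)))); first lra.
  by rewrite divr_gt0//; have := edge_height_next (ord_pred i); rewrite e.
Qed.

(** A point of the polygon lies in the triangle on the side where [g] is minimal. *)
Lemma halfplanes_triangles : (0 < n)%N ->
  halfplanes = \bigcup_(i in [set: 'I_n]) triangle C (A i) (A (ordS i)).
Proof.
move=> n0; apply/seteqP; split=> X.
  move=> KX; exists [arg min_(i < Ordinal n0) g i X]%O => //.
  case: arg_minP => // i _ gmin; apply/triangle_reldist; split.
    by rewrite divr_ge0// ltW.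
  by move=> j; exact: gmin.
move=> [i _] /triangle_reldist[gi gij] j.
have := le_trans gi (gij j).
by rewrite pmulr_lge0// invr_gt0.
Qed.

(** The value 0 is minimal among the [g j X], so [X] lies in the triangle on side [i]; there
    [g i X = 1 - s - t], whence [s + t = 1]. *)
Lemma halfplanes_edge i X : halfplanes X -> h i X = 0 ->
  segment (A i) (A (ordS i)) X.
Proof.
move=> KX hi0.
have gi0 : g i X = 0 by rewrite /g hi0 mul0r.
have : triangle C (A i) (A (ordS i)) X.
  by apply/triangle_reldist; rewrite gi0; split => // j; rewrite divr_ge0// ltW.
rewrite /triangle/=; have := baryE X (orientC_neq0 i); move: gi0.
move: (baryl _ _ _ _) (baryr _ _ _ _) => s t + eX [s0 t0 st].
rewrite {1}eX reldist_comb /g edge_height_left edge_height_right.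
rewrite !mul0r !mulr0 !addr0 => st1.
exists t; first by rewrite /= in_itv/=; apply/andP; split; lra.
rewrite eX; have -> : s = 1 - t by lra.
by rewrite [LHS]surjective_pairing [RHS]surjective_pairing !pairE; congr (_, _); ring.
Qed.

Lemma sidesE : sides A = [set X | halfplanes X /\ exists i, h i X = 0].
Proof.
apply/seteqP; split=> X; last by move=> [KX [i hi]]; exists i => //; exact: halfplanes_edge.
move=> sX; split; first exact: sides_halfplanes.
case: sX => i _ [t _ <-]; exists i.
by rewrite edge_height_seg edge_height_left edge_height_right !mulr0 addr0.
Qed.

(** Both ends of side [i] lie on side [j]. If [A i] were strictly inside side [j], the height over
    the side before [i], nonnegative at both ends of side [j] and 0 at [A i], would vanish on all of
    side [j], hence at [A (ordS i)], against strict convexity. *)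
Lemma same_edge_line i j : (forall X, g i X = g j X) -> i = j \/ i = ordS j.
Proof.
move=> e.
have he X : h i X = 0 -> h j X = 0.
  move=> hi; have := e X; rewrite /g hi mul0r => /esym/eqP.
  by rewrite mulf_eq0 invr_eq0 [h j C == 0]gt_eqF// orbF => /eqP.
have [w /= + wE] : segment (A j) (A (ordS j)) (A i).
  by apply: halfplanes_edge (he _ (edge_height_left i)) => k; exact: edge_height_ge0.
rewrite in_itv/= => /andP[w0 w1].
have [w' /= + wE'] : segment (A j) (A (ordS j)) (A (ordS i)).
  by apply: halfplanes_edge (he _ (edge_height_right i)) => k; exact: edge_height_ge0.
rewrite in_itv/= => /andP[w0' w1'].
have [injA _ _ _] := oA.
have [w_0|w_0] := eqVneq w 0.
  by left; apply: injA; rewrite -wE w_0 scale0r addr0.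
have [w_1|w_1] := eqVneq w 1.
  by right; apply: injA; rewrite -wE w_1 scale1r addrC subrK.
have ei : ordS (ord_pred i) = i by exact: ord_predK.
have := edge_height_right (ord_pred i); have := edge_height_next (ord_pred i).
rewrite ei -wE -wE' !edge_height_seg.
have := edge_height_ge0 (ord_pred i) j; have := edge_height_ge0 (ord_pred i) (ordS j).
move: (h _ _) (h _ _) => a b b0 a0 gt0 ab0.
have {}w_0 : 0 < w by rewrite lt_neqAle eq_sym w_0.
have {}w_1 : 0 < 1 - w by rewrite subr_gt0 lt_neqAle w_1.
have := mulr_ge0 (ltW w_1) a0; have := mulr_ge0 (ltW w_0) b0 => wb wa.
have a_0 : a = 0 by apply: (mulfI (lt0r_neq0 w_1)); lra.
have b_0 : b = 0 by apply: (mulfI (lt0r_neq0 w_0)); lra.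
by move: gt0; rewrite a_0 b_0 !mulr0 addr0 ltxx.
Qed.

Lemma reldist_inj i j : (forall X, g i X = g j X) -> i = j.
Proof.
move=> e; case: (same_edge_line e) => // ij.
case: (@same_edge_line j i) => // ji.
by have := edge_height_next j; rewrite -ij -ji edge_height_left ltxx.
Qed.

(** On the overlap [g i] and [g j] agree. This is the equation of a line: if the linear parts were
    equal, so would be the functions, both being 1 at [C], and then [i = j]. *)
Lemma triangles_overlap i j : i != j ->
  mu2 (triangle C (A i) (A (ordS i)) `&` triangle C (A j) (A (ordS j))) = 0%E.
Proof.
move=> ij.
pose a k := sg * (((A k).2 - (A (ordS k)).2)) / h k C.
pose b k := sg * ((A (ordS k)).1 - (A k).1) / h k C.
pose c k := sg * ((A k).1 * (A (ordS k)).2 - (A (ordS k)).1 * (A k).2) / h k C.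
have gE k X : g k X = a k * X.1 + b k * X.2 + c k.
  by rewrite /g {1}/h orient_lin /a /b /c; ring.
have ab : (a i - a j != 0) || (b i - b j != 0).
  apply: contraNT ij; rewrite negb_or !negbK => /andP[/eqP ea /eqP eb].
  have gC k : g k C = 1 by rewrite /g mulfV// gt_eqF.
  apply/eqP/reldist_inj => X; have := gC i; have := gC j; rewrite !gE.
  have -> : a i = a j by lra.
  have -> : b i = b j by lra.
  lra.
apply: (subset_measure0 _ _ _ (measure_line (c i - c j) ab)).
- by apply: measurableI; exact: measurable_triangle.
- exact: measurable_line.
- move=> X [/triangle_reldist[_ gi] /triangle_reldist[_ gj]] /=.
  have : g i X = g j X by apply/eqP; rewrite eq_le gi gj.
  by rewrite !gE => gij; lra.
Qed.

Lemma measure_halfplanes : (0 < n)%N ->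
  mu2 halfplanes = (\sum_(i < n) h i C / 2)%:E.
Proof.
move=> n0; rewrite halfplanes_triangles// measure_bigcup_null.
- rewrite -sumEFin; apply: eq_bigr => i _.
  rewrite [LHS]measure_triangle//; congr (_ / 2)%:E.
  rewrite orient_rot -[RHS]gtr0_norm// /h normrM.
  by have [_ [->|->] _ _] := oA; rewrite ?normrN normr1 mul1r.
- by move=> i; exact: measurable_triangle.
- exact: triangles_overlap.
Qed.

Lemma continuous_edge_height j : continuous (h j).
Proof.
move=> X; apply: cvgM; first exact: cvg_cst.
apply: cvgB; apply: cvgM; try exact: cvg_cst;
  apply: cvgB; try exact: cvg_cst; [exact: cvg_snd|exact: cvg_fst].
Qed.

Lemma closed_halfplanes : closed halfplanes.
Proof.
have -> : halfplanes = \bigcap_(j in [set: 'I_n]) (h j @^-1` [set x | 0 <= x]).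
  by apply/seteqP; split=> X HX j => [_|]; exact: HX.
apply: closed_bigI => j _; apply: preimage_closed => [X _|]; last exact: closed_ge.
exact: continuous_edge_height.
Qed.

Lemma open_strict_halfplanes : open [set X : R * R | forall j, 0 < h j X].
Proof.
rewrite openE => X hX.
apply: (@filter_forall _ _ (fun j => [set Y | 0 < h j Y]) (nbhs X)) => j.
apply: open_nbhs_nbhs; split; last exact: (hX j).
apply: (@open_comp _ _ (h j) [set x | 0 < x]) => [Y _|]; last exact: open_gt.
exact: continuous_edge_height.
Qed.

Lemma halfplanes_bounded : (0 < n)%N ->
  exists B : R, forall X, halfplanes X -> `|X : R * R| <= B.
Proof.
move=> n0; exists (`|C| + \sum_(k < n) (`|A k - C| + `|A (ordS k) - C|)) => X.
rewrite halfplanes_triangles// => -[i _] [].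
have := baryE X (orientC_neq0 i).
move: (baryl _ _ _ _) (baryr _ _ _ _) => s t -> s0 t0 st.
rewrite -addrA (le_trans (ler_normD _ _))// lerD2l.
rewrite (bigD1 i)//=; apply: (@le_trans _ _ (`|A i - C| + `|A (ordS i) - C|)).
  2: by rewrite lerDl sumr_ge0.
rewrite (le_trans (ler_normD _ _))// !normrZ.
by rewrite lerD// ler_piMl// ger0_norm//; lra.
Qed.

(** An outside point can escape to infinity without meeting the sides, while the component of an
    inside point is trapped in the bounded set [halfplanes]. *)
Lemma regionE : (0 < n)%N -> region A = halfplanes.
Proof.
move=> n0; apply/seteqP; split=> X.
  case=> [|[nsX [M [_ bM]]]]; first exact: sides_halfplanes.
  apply: contrapT => nKX.
  have [j hj] : exists j, h j X < 0.
    apply: contrapT => nj; apply: nKX => j; rewrite leNgt; apply/negP => hj.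
    by apply: nj; exists j.
  (* Beyond [X] the ray from [C] keeps the height over side [j] negative, so it avoids the sides and
     stays in the component of [X]. *)
  pose ray t := C + t *: (X - C) : R * R.
  have raysub : ray @` `[1, +oo[ `<=` connected_component (~` sides A) X.
    apply: connected_component_max.
    - by exists 1; [rewrite /= in_itv/= lexx|rewrite /ray scale1r addrC subrK].
    - move=> _ [t /= + <-]; rewrite in_itv/= andbT => t1 /sides_halfplanes/(_ j).
      rewrite /ray edge_height_seg leNgt => /negP; apply.
      have := hC j; nra.
    - apply: connected_continuous_connected.
        apply/connected_intervalP; exact: interval_is_interval.
      apply: continuous_subspaceT => t.
      by apply: cvgD; [exact: cvg_cst|apply: cvgZl; exact: cvg_id].
  have XC : X != C.
    by apply: contraTneq hj => ->; rewrite -leNgt ltW.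
  have nXC : 0 < `|X - C : R * R| by rewrite normr_gt0 subr_eq0.
  (* The parameter [t] is chosen so that [t *: (X - C)] has norm [L] plus that of [X - C], too large
     for the bound on [ray t]. *)
  pose L := `|M| + 1 + `|C|.
  have L0 : 0 <= L by rewrite /L !addr_ge0.
  pose t := L / `|X - C| + 1.
  have t1 : 1 <= t by rewrite /t lerDr divr_ge0.
  have /= rayM : `|ray t : R * R| <= `|M| + 1.
    apply: (bM (`|M| + 1)); first by rewrite ltr_pwDr// ler_norm.
    by apply: raysub; exists t => //; rewrite /= in_itv/= t1.
  have : `|t *: (X - C) : R * R| <= L.
    have -> : t *: (X - C) = ray t - C by rewrite /ray addrAC subrr add0r.
    by rewrite (le_trans (ler_normB _ _))// /L lerD2r.
  rewrite normrZ ger0_norm; last by rewrite (le_trans _ t1).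
  by rewrite /t mulrDl divfK ?gt_eqF// mul1r leNgt ltrDl nXC.
move=> KX; have [sX|nsX] := pselect (sides A X); [by left|right; split => //].
set D := connected_component _ X.
have DX : D X by exact: connected_component_refl.
(* Away from the sides the weak and the strict half-plane conditions coincide, so [halfplanes] cuts
   out a nonempty subset of [D] that is both open and closed in it; [D] is connected. *)
have -> : D = D `&` halfplanes.
  have DE : D `&` halfplanes = D `&` [set Y : R * R | forall j, 0 < h j Y].
    apply/seteqP; split=> Y [DY KY]; split=> // j; last exact: ltW.
    rewrite lt_neqAle KY andbT eq_sym; apply/eqP => hY.
    by apply: (connected_component_sub DY); rewrite sidesE; split => //; exists j.
  apply/esym; apply: component_connected; first by exists X.
  - exists [set Y : R * R | forall j, 0 < h j Y] => //.
    exact: open_strict_halfplanes.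
  - by exists halfplanes => //; exact: closed_halfplanes.
have [B hB] := halfplanes_bounded n0.
exists B; split; first exact: num_real.
by move=> M BM Y [_ /hB]; rewrite /= => hY; rewrite (le_trans hY)// ltW.
Qed.

(** The apex [C] is free: it will be the incenter for [A] and the point [O + O - I] for [M]. *)
Lemma areaE : (0 < n)%N -> area A = \sum_(i < n) h i C / 2.
Proof. by move=> n0; rewrite /area regionE// measure_halfplanes. Qed.
End InteriorPoint.
End Oriented.
End ConvexPolygon.

(** * Tangent circles *)

Section Metric.
Context {R : realType}.
Implicit Types P Q C X T u v : R * R.

Definition rot90 u : R * R := (- u.2, u.1).
Definition unit_vector u := u.1 ^+ 2 + u.2 ^+ 2 = 1.

Lemma edist_sqr P Q : Defs.edist P Q ^+ 2 = (P.1 - Q.1) ^+ 2 + (P.2 - Q.2) ^+ 2.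
Proof. by rewrite /Defs.edist sqr_sqrtr// addr_ge0// sqr_ge0. Qed.

(** The radius at the contact point is normal to the line, since otherwise the line would meet the
    circle twice. The sign [d] records the side on which the center lies. *)
Lemma tangent_normal C (r : R) P Q (S : set (R * R)) u (l : R) :
  0 < r -> unit_vector u -> l != 0 -> Q = P + l *: rot90 u ->
  tangent_at_part C r P Q S ->
  exists T, exists d : R, [/\ S T, d ^+ 2 = 1 & C = T + (d * r) *: u].
Proof.
rewrite /unit_vector => r0 uu l0 -> [T ST cT].
have [cTr [t _ tT]] : (circle C r `&` line P (P + l *: rot90 u)) T by rewrite cT.
(* The tangential component of [C - T]; the point [T + (2 * m) *: rot90 u], the mirror image of [T]
   in the foot of [C], is on the circle too. *)
pose m := (C.2 - T.2) * u.1 - (C.1 - T.1) * u.2.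
have m0 : m = 0.
  have : (circle C r `&` line P (P + l *: rot90 u)) (T + (2 * m) *: rot90 u).
    split.
      rewrite /circle/= -cTr /Defs.edist; congr Num.sqrt.
      rewrite !pairE /=.
      have -> : (C.1 - (T.1 + 2 * m * - u.2)) ^+ 2 + (C.2 - (T.2 + 2 * m * u.1)) ^+ 2 =
        (C.1 - T.1) ^+ 2 + (C.2 - T.2) ^+ 2 - 4 * m * m + 4 * m ^+ 2 * (u.1 ^+ 2 + u.2 ^+ 2).
        by rewrite /m; ring.
      by rewrite uu; ring.
    exists (t + 2 * m / l) => //.
    rewrite -tT [LHS]surjective_pairing [RHS]surjective_pairing !pairE/=.
    by congr (_, _); field.
  rewrite cT /= => e.
  have e1 : m * u.2 = 0 by have := congr1 fst e; rewrite !pairE/=; lra.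
  have e2 : m * u.1 = 0 by have := congr1 snd e; rewrite !pairE/=; lra.
  by rewrite -[m]mulr1 -uu !expr2 mulrDr !mulrA e1 e2; ring.
pose p := (C.1 - T.1) * u.1 + (C.2 - T.2) * u.2.
have Cp1 : C.1 - T.1 = p * u.1.
  have -> : C.1 - T.1 = (C.1 - T.1) * (u.1 ^+ 2 + u.2 ^+ 2) by rewrite uu mulr1.
  by rewrite -[RHS]subr0 -(mulr0 u.2) -m0 /m /p; ring.
have Cp2 : C.2 - T.2 = p * u.2.
  have -> : C.2 - T.2 = (C.2 - T.2) * (u.1 ^+ 2 + u.2 ^+ 2) by rewrite uu mulr1.
  by rewrite -[RHS]addr0 -(mulr0 u.1) -m0 /m /p; ring.
exists T, (p / r); split=> //.
  have : p ^+ 2 = r ^+ 2.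
    rewrite -cTr edist_sqr Cp1 Cp2 !exprMn -mulrDr uu mulr1//.
  by move=> pr; rewrite expr_div_n pr divff// expf_neq0// gt_eqF.
rewrite divfK ?gt_eqF//.
rewrite [LHS]surjective_pairing [RHS]surjective_pairing !pairE/=.
by congr (_, _); lra.
Qed.

(** Multiplicativity of the norm of complex numbers; for a unit vector it computes a squared length
    in a rotated frame. *)
Lemma rot_norm (p q a b : R) :
  (p * a - q * b) ^+ 2 + (p * b + q * a) ^+ 2 = (p ^+ 2 + q ^+ 2) * (a ^+ 2 + b ^+ 2).
Proof. by ring. Qed.

Lemma sqr_inj_ge0 (x y : R) : 0 <= x -> 0 <= y -> x ^+ 2 = y ^+ 2 -> x = y.
Proof. by move=> x0 y0 /eqP; rewrite eqrXn2// => /eqP. Qed.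

(* Here u and v are the normals of the two sides at a vertex, and x, y the
   tangent lengths of the incircle there. The circle of radius rho touches the
   side normal to u, and the other side beyond the vertex; [ep] and [de] tell on
   which side of these lines its center lies. *)
Lemma bisector (s r x y al be rho ep de u1 u2 v1 v2 : R) :
  s ^+ 2 = 1 -> u1 ^+ 2 + u2 ^+ 2 = 1 -> v1 ^+ 2 + v2 ^+ 2 = 1 ->
  0 <= x -> 0 <= y -> 0 <= al -> 0 <= be -> 0 < rho ->
  ep ^+ 2 = 1 -> de ^+ 2 = 1 ->
  r * u1 + x * s * u2 = r * v1 - y * s * v2 ->
  r * u2 - x * s * u1 = r * v2 + y * s * v1 ->
  ep * rho * u1 - al * s * u2 = de * rho * v1 - be * s * v2 ->
  ep * rho * u2 + al * s * u1 = de * rho * v2 + be * s * v1 ->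
  0 < s * (v1 * u2 - v2 * u1) ->
  ep = 1 /\ r * rho = al * x.
Proof.
move=> ss uu vv x0 y0 al0 be0 rho0 ep1 de1 V1 V2 W1 W2 cr.
have xy : x = y.
  apply: sqr_inj_ge0 => //.
  have := rot_norm r (y * s) v1 v2; rewrite -V1 -V2 vv.
  have -> : r * u1 + x * s * u2 = r * u1 - (- x * s) * u2 by ring.
  have -> : r * u2 - x * s * u1 = r * u2 + (- x * s) * u1 by ring.
  by rewrite rot_norm uu !exprMn ss sqrrN; lra.
have ab : al = be.
  apply: sqr_inj_ge0 => //.
  have := rot_norm (de * rho) (be * s) v1 v2; rewrite -W1 -W2 rot_norm uu vv.
  by rewrite !exprMn ss ep1 de1; lra.
subst y be.
have [de_ep|de_ep] : de = ep \/ de = - ep.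
  have /eqP : (de - ep) * (de + ep) = 0 by rewrite -subr_sqr ep1 de1 subrr.
  by rewrite mulf_eq0 subr_eq0 addr_eq0 => /orP[/eqP|/eqP]; [left|right].
  (* Equal signs would put the center on the inner bisector. Taking the scalar product with [u - v]
     removes the rotated terms and forces [u = v], against the strict turn. *)
  subst de; exfalso.
  have : ep * rho * ((u1 - v1) ^+ 2 + (u2 - v2) ^+ 2) = 0.
    transitivity ((ep * rho * u1 - al * s * u2 - (ep * rho * v1 - al * s * v2)) * (u1 - v1) +
     (ep * rho * u2 + al * s * u1 - (ep * rho * v2 + al * s * v1)) * (u2 - v2)); first by ring.
    by rewrite W1 W2 !subrr; ring.
  move=> /eqP; rewrite mulf_eq0 mulf_eq0 (gt_eqF rho0) orbF -sqrf_eq0 ep1 oner_eq0/=.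
  rewrite paddr_eq0 ?sqr_ge0// !sqrf_eq0 !subr_eq0 => /andP[/eqP e1 /eqP e2].
  by move: cr; rewrite e1 e2 mulrC [v1 * v2]mulrC subrr mul0r ltxx.
subst de.
pose N := (u1 + v1) ^+ 2 + (u2 + v2) ^+ 2.
have N0 : 0 < N.
  rewrite lt_neqAle eq_sym addr_ge0 ?sqr_ge0// andbT.
  apply/eqP => /eqP; rewrite paddr_eq0 ?sqr_ge0// !sqrf_eq0 !addr_eq0 => /andP[/eqP e1 /eqP e2].
  by move: cr; rewrite e1 e2 !mulrN [v1 * v2]mulrC subrr mulr0 ltxx.
(* The scalar product of the two expressions of the excenter with [u + v]; its right-hand side is
   nonnegative, which fixes the sign [ep]. *)
have epE : ep * rho * N = 2 * al * (s * (v1 * u2 - v2 * u1)).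
  transitivity ((ep * rho * u1 - al * s * u2 - (- ep * rho * v1 - al * s * v2)) * (u1 + v1) +
     (ep * rho * u2 + al * s * u1 - (- ep * rho * v2 + al * s * v1)) * (u2 + v2) +
     2 * al * (s * (v1 * u2 - v2 * u1))); first by rewrite /N; ring.
  by rewrite W1 W2 !subrr; ring.
have ep_1 : ep = 1.
  have : 0 <= ep * rho * N by rewrite epE; apply: mulr_ge0; [lra|exact: ltW].
  rewrite pmulr_lge0// pmulr_lge0// => ep0.
  by apply: sqr_inj_ge0; rewrite ?expr1n.
split=> //; subst ep.
apply: (mulIf (lt0r_neq0 N0)).
(* The same computation for the incircle, with the cross product by [u + v]. The resulting relation
   [r * rho = al * x] says that the two bisectors are perpendicular. *)
have VE : r * ((u1 - v1) * (u2 + v2) - (u2 - v2) * (u1 + v1)) * s = - x * N.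
  transitivity (s * ((r * u1 + x * s * u2 - (r * v1 - x * s * v2)) * (u2 + v2) -
     (r * u2 - x * s * u1 - (r * v2 + x * s * v1)) * (u1 + v1)) - x * s ^+ 2 * N).
    by rewrite /N; ring.
  by rewrite V1 V2 !subrr ss; ring.
have -> : r * rho * N = r * (1 * rho * N) by ring.
rewrite epE.
have -> : al * x * N = - al * (- x * N) by ring.
by rewrite -VE; ring.
Qed.

(* [u] is the outward normal of PQ, I + r u is the contact point of the incircle,
   and x, y are the tangent lengths from P and Q. *)
Definition side_frame (s : R) I (r : R) P Q u (x y : R) :=
  [/\ unit_vector u, 0 <= x, 0 <= y, 0 < x + y &
      P = I + r *: u - (x * s) *: rot90 u /\ Q = I + r *: u + (y * s) *: rot90 u].

Lemma side_frame_exists (s : R) I (r : R) P Q : s ^+ 2 = 1 -> 0 < r -> P != Q ->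
  0 <= s * orient P Q I -> tangent_to_segment I r P Q ->
  exists u x y, side_frame s I r P Q u x y.
Proof.
move=> ss r0 PQ oI tI.
pose l := Defs.edist P Q.
have l2 : (Q.1 - P.1) ^+ 2 + (Q.2 - P.2) ^+ 2 = l ^+ 2 by rewrite edist_sqr; ring.
have l0 : 0 < l.
  rewrite sqrtr_gt0 lt_neqAle eq_sym addr_ge0 ?sqr_ge0// andbT.
  rewrite paddr_eq0 ?sqr_ge0// !sqrf_eq0 !subr_eq0; apply: contra PQ => /andP[/eqP e1 /eqP e2].
  by rewrite [P]surjective_pairing e1 e2 -surjective_pairing.
(* The unit direction of PQ turned by a right angle, clockwise for [s = 1] and counterclockwise for
   [s = -1], hence outward. *)
pose u : R * R := (s * (Q.2 - P.2) / l, - s * (Q.1 - P.1) / l).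
have uu : unit_vector u.
  rewrite /unit_vector /u/= !expr_div_n !exprMn sqrrN ss !mul1r -mulrDl addrC l2.
  by rewrite divff// expf_neq0// gt_eqF.
have lN0 := lt0r_neq0 l0.
have QE : Q = P + (l * s) *: rot90 u.
  rewrite [LHS]surjective_pairing [RHS]surjective_pairing !pairE/=; congr (_, _).
    transitivity (P.1 + s ^+ 2 * (Q.1 - P.1)); first by rewrite ss; ring.
    by field.
  transitivity (P.2 + s ^+ 2 * (Q.2 - P.2)); first by rewrite ss; ring.
  by field.
have ls0 : l * s != 0.
  by rewrite mulf_neq0// -sqrf_eq0 ss oner_eq0.
have [_ [d [[t /= + <-] dd IE]]] := tangent_normal r0 uu ls0 QE tI.
rewrite in_itv/= => /andP[t0 t1].
(* The other sign would put the incenter strictly on the outer side of PQ. *)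
have dN1 : d = -1.
  have /eqP : (d - 1) * (d + 1) = 0 by rewrite -subr_sqr dd expr1n subrr.
  rewrite mulf_eq0 subr_eq0 addr_eq0 => /orP[/eqP d1|/eqP//].
  move: oI; rewrite IE d1.
  have -> : s * orient P Q (P + t *: (Q - P) + (1 * r) *: u) =
    - (r * l) * s ^+ 2 * (u.1 ^+ 2 + u.2 ^+ 2).
    by rewrite QE /orient !pairE /=; ring.
  by rewrite ss uu !mulr1 oppr_ge0 leNgt mulr_gt0.
exists u, (t * l), ((1 - t) * l); split => //.
- by rewrite mulr_ge0// ltW.
- by rewrite mulr_ge0 ?subr_ge0// ltW.
- by rewrite -mulrDl addrC subrK mul1r.
have -> : I + r *: u = P + t *: (Q - P).
  by rewrite IE dN1 mulN1r scaleNr subrK.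
rewrite [in t *: (Q - P)]QE; split.
  rewrite [LHS]surjective_pairing [RHS]surjective_pairing !pairE/=.
  by congr (_, _); ring.
rewrite [LHS]surjective_pairing [RHS]surjective_pairing !pairE/=.
by rewrite {1 2}QE !pairE/=; congr (_, _); ring.
Qed.

Lemma side_frame_orient (s : R) I (r : R) P Q u (x y : R) X : s ^+ 2 = 1 ->
  side_frame s I r P Q u x y ->
  s * orient P Q X = (x + y) * (r - ((X.1 - I.1) * u.1 + (X.2 - I.2) * u.2)).
Proof.
move=> ss [uu _ _ _ [-> ->]].
transitivity (s ^+ 2 * (x + y) * (r * (u.1 ^+ 2 + u.2 ^+ 2) -
   ((X.1 - I.1) * u.1 + (X.2 - I.2) * u.2))).
  by rewrite /orient !pairE/=; ring.
by rewrite ss uu; ring.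
Qed.

Lemma side_frame_cross (s : R) I (r : R) P Q X u v (x y x' y' : R) : s ^+ 2 = 1 ->
  side_frame s I r P Q u x y -> side_frame s I r Q X v x' y' ->
  0 < s * orient P Q X -> 0 < s * (u.1 * v.2 - u.2 * v.1).
Proof.
move=> ss fu fv; rewrite (side_frame_orient X ss fu).
case: (fu) => uu _ _ xy [_ QE]; case: fv => vv _ _ xy' [QE' ->].
rewrite pmulr_rgt0//.
have -> : I + r *: v + (y' * s) *: rot90 v =
   I + r *: u + (y * s) *: rot90 u + ((x' + y') * s) *: rot90 v.
  rewrite -QE QE' [LHS]surjective_pairing [RHS]surjective_pairing !pairE/=.
  by congr (_, _); ring.
rewrite !pairE/=.
have -> : r - ((I.1 + r * u.1 + y * s * - u.2 + (x' + y') * s * - v.2 - I.1) * u.1 +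
     (I.2 + r * u.2 + y * s * u.1 + (x' + y') * s * v.1 - I.2) * u.2) =
   r - r * (u.1 ^+ 2 + u.2 ^+ 2) + (x' + y') * (s * (u.1 * v.2 - u.2 * v.1)) by ring.
by rewrite uu mulr1 subrr add0r pmulr_rgt0.
Qed.

(** The bisector relations at the two ends read [r * rho = al * x] and [r * rho = (x + y - al) * y],
    where [al] is the distance from [P] to the contact point. Hence [al = y] and
    [rho = x * y / r]. *)
Lemma excenterE (s : R) I (r rho : R) P0 P Q Q1 C u v w (x y x' y' x'' y'' : R) :
  s ^+ 2 = 1 -> 0 < r ->
  side_frame s I r P0 P v x' y' -> side_frame s I r P Q u x y ->
  side_frame s I r Q Q1 w x'' y'' ->
  0 < s * (v.1 * u.2 - v.2 * u.1) -> 0 < s * (u.1 * w.2 - u.2 * w.1) -> 0 < rho ->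
  tangent_to_segment C rho P Q -> tangent_to_extension C rho P0 P ->
  tangent_to_extension C rho Q1 Q ->
  C = I + (r + x * y / r) *: u + ((y - x) * s) *: rot90 u.
Proof.
move=> ss r0 [vv x'0 y'0 xy' [P0E PE']] [uu x0 y0 xy [PE QE]].
move=> [ww x''0 y''0 xy'' [QE' Q1E]] vu uw rho0 tPQ tP tQ.
have sN0 : s != 0 by rewrite -sqrf_eq0 ss oner_eq0.
have chordE X Y T (a b : R) z : X = T - (a * s) *: rot90 z -> Y = T + (b * s) *: rot90 z ->
    Y = X + ((a + b) * s) *: rot90 z.
  move=> -> ->; rewrite [LHS]surjective_pairing [RHS]surjective_pairing !pairE/=.
  by congr (_, _); ring.
have PQ := chordE _ _ _ _ _ _ PE QE.
have P0P := chordE _ _ _ _ _ _ P0E PE'.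
have Q1Q : Q = Q1 + (- ((x'' + y'') * s)) *: rot90 w.
  by rewrite (chordE _ _ _ _ _ _ QE' Q1E) scaleNr addrK.
have lN0 (a : R) : 0 < a -> a * s != 0 by move=> a0; rewrite mulf_neq0// gt_eqF.
have [_ [ep [[t /= + <-] epep CE]]] := tangent_normal rho0 uu (lN0 _ xy) PQ tPQ.
rewrite in_itv/= => /andP[t0 t1].
have [_ [de [[t' /= + <-] dede CE']]] := tangent_normal rho0 vv (lN0 _ xy') P0P tP.
rewrite in_itv/= andbT => t'1.
have lN0'' : - ((x'' + y'') * s) != 0 by rewrite oppr_eq0 lN0.
have [_ [de' [[t'' /= + <-] dede' CE'']]] := tangent_normal rho0 ww lN0'' Q1Q tQ.
rewrite in_itv/= andbT => t''1.
have al0 : 0 <= t * (x + y) by rewrite mulr_ge0// ltW.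
have al0' : 0 <= (1 - t) * (x + y) by rewrite mulr_ge0 ?subr_ge0// ltW.
have be0 : 0 <= (t' - 1) * (x' + y') by rewrite mulr_ge0 ?subr_ge0// ltW.
have be0' : 0 <= (t'' - 1) * (x'' + y'') by rewrite mulr_ge0 ?subr_ge0// ltW.
have C1 : C = P + (ep * rho) *: u + (t * (x + y) * s) *: rot90 u.
  rewrite CE PQ [LHS]surjective_pairing [RHS]surjective_pairing !pairE/=.
  by congr (_, _); ring.
have C2 : C = P + (de * rho) *: v + ((t' - 1) * (x' + y') * s) *: rot90 v.
  rewrite CE' P0P [LHS]surjective_pairing [RHS]surjective_pairing !pairE/=.
  by congr (_, _); ring.
have C1' : C = Q + (ep * rho) *: u - ((1 - t) * (x + y) * s) *: rot90 u.
  rewrite C1 PQ [LHS]surjective_pairing [RHS]surjective_pairing !pairE/=.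
  by congr (_, _); ring.
have C3 : C = Q + (de' * rho) *: w - ((t'' - 1) * (x'' + y'') * s) *: rot90 w.
  rewrite CE'' Q1Q [LHS]surjective_pairing [RHS]surjective_pairing !pairE/=.
  by congr (_, _); ring.
have [ep1 b1] : ep = 1 /\ r * rho = (t * (x + y)) * x.
  apply: (@bisector s r x y' (t * (x + y)) ((t' - 1) * (x' + y')) rho ep de
    u.1 u.2 v.1 v.2) => //.
  - by have := congr1 fst PE; rewrite {1}PE' !pairE/=; lra.
  - by have := congr1 snd PE; rewrite {1}PE' !pairE/=; lra.
  - by have := congr1 fst C1; rewrite {1}C2 !pairE/=; lra.
  - by have := congr1 snd C1; rewrite {1}C2 !pairE/=; lra.
(* Seen from [Q] the side is traversed backwards, which replaces [s] by [- s]. *)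
have [_ b2] : ep = 1 /\ r * rho = ((1 - t) * (x + y)) * y.
  apply: (@bisector (- s) r y x'' ((1 - t) * (x + y)) ((t'' - 1) * (x'' + y'')) rho ep de'
    u.1 u.2 w.1 w.2) => //.
  - by rewrite sqrrN.
  - by have := congr1 fst QE; rewrite {1}QE' !pairE/=; lra.
  - by have := congr1 snd QE; rewrite {1}QE' !pairE/=; lra.
  - by have := congr1 fst C1'; rewrite {1}C3 !pairE/=; lra.
  - by have := congr1 snd C1'; rewrite {1}C3 !pairE/=; lra.
  - by move: uw; lra.
have tE : t * (x + y) = y by apply: (mulIf (lt0r_neq0 xy)); lra.
rewrite C1 ep1 tE PE.
have -> : rho = x * y / r.
  by apply: (mulfI (lt0r_neq0 r0)); rewrite b1 tE mulrCA divff ?gt_eqF// mulr1 mulrC.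
rewrite [LHS]surjective_pairing [RHS]surjective_pairing !pairE/=.
by congr (_, _); ring.
Qed.

Lemma circumcenter_power (s : R) I (r : R) P Q C O (rO : R) u (x y : R) :
  s ^+ 2 = 1 -> 0 < r -> side_frame s I r P Q u x y ->
  Defs.edist O P = rO -> Defs.edist O Q = rO ->
  C = I + (r + x * y / r) *: u + ((y - x) * s) *: rot90 u ->
  C = (O + O - I) + ((rO ^+ 2 - Defs.edist O I ^+ 2) / r) *: u.
Proof.
move=> ss r0 [uu _ _ xy [PE QE]] OP OQ ->.
pose p := (O.1 - I.1) * - u.2 * s + (O.2 - I.2) * u.1 * s.
pose q := (O.1 - I.1) * u.1 + (O.2 - I.2) * u.2.
have O1 : O.1 = I.1 - p * s * u.2 + q * u.1.
  transitivity (I.1 + (O.1 - I.1) * (u.1 ^+ 2 + s ^+ 2 * u.2 ^+ 2) +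
    (O.2 - I.2) * (1 - s ^+ 2) * u.1 * u.2); last by rewrite /p /q; ring.
  by rewrite ss mul1r uu; ring.
have O2 : O.2 = I.2 + p * s * u.1 + q * u.2.
  transitivity (I.2 + (O.2 - I.2) * (u.2 ^+ 2 + s ^+ 2 * u.1 ^+ 2) +
    (O.1 - I.1) * (1 - s ^+ 2) * u.1 * u.2); last by rewrite /p /q; ring.
  by rewrite ss mul1r [u.2 ^+ 2 + _]addrC uu; ring.
have RP : rO ^+ 2 = (q - r) ^+ 2 + (p + x) ^+ 2.
  rewrite -OP edist_sqr PE !pairE/= O1 O2.
  transitivity (((q - r) ^+ 2 + s ^+ 2 * (p + x) ^+ 2) * (u.1 ^+ 2 + u.2 ^+ 2)); first by ring.
  by rewrite uu ss; ring.
have RQ : rO ^+ 2 = (q - r) ^+ 2 + (p - y) ^+ 2.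
  rewrite -OQ edist_sqr QE !pairE/= O1 O2.
  transitivity (((q - r) ^+ 2 + s ^+ 2 * (p - y) ^+ 2) * (u.1 ^+ 2 + u.2 ^+ 2)); first by ring.
  by rewrite uu ss; ring.
have dI : Defs.edist O I ^+ 2 = q ^+ 2 + p ^+ 2.
  rewrite edist_sqr O1 O2.
  transitivity ((q ^+ 2 + s ^+ 2 * p ^+ 2) * (u.1 ^+ 2 + u.2 ^+ 2)); first by ring.
  by rewrite uu ss; ring.
have pE : p = (y - x) / 2.
  have : (x + y) * (2 * p + x - y) = 0.
    have -> : 0 = rO ^+ 2 - rO ^+ 2 by rewrite subrr.
    by rewrite {1}RP RQ; ring.
  by move=> /eqP; rewrite mulf_eq0 gt_eqF//= => /eqP; lra.
have rN0 := lt0r_neq0 r0.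
rewrite RP dI [LHS]surjective_pairing [RHS]surjective_pairing !pairE/= O1 O2 pE.
by congr (_, _); field.
Qed.

(** The first two equations express the common vertex in the frames of its two sides, the others the
    two excenters. The conclusion makes the segment of the excenters a multiple of the vector from
    incenter to vertex turned by a right angle: it runs along the external bisector. *)
Lemma chord_excenters (s r k x y x' y' u1 u2 v1 v2 E1 E2 I1 I2 : R) :
  s ^+ 2 = 1 -> r != 0 ->
  r * u1 - y * s * u2 = r * v1 + x' * s * v2 ->
  r * u2 + y * s * u1 = r * v2 - x' * s * v1 ->
  E1 + k * u1 = I1 + (r + x * y / r) * u1 - (y - x) * s * u2 ->
  E2 + k * u2 = I2 + (r + x * y / r) * u2 + (y - x) * s * u1 ->
  E1 + k * v1 = I1 + (r + x' * y' / r) * v1 - (y' - x') * s * v2 ->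
  E2 + k * v2 = I2 + (r + x' * y' / r) * v2 + (y' - x') * s * v1 ->
  r * k * (v1 - u1) = - ((x + y') * s * (r * u2 + y * s * u1)) /\
  r * k * (v2 - u2) = (x + y') * s * (r * u1 - y * s * u2).
Proof.
move=> ss rN0 V1 V2 M1 M2 M1' M2'.
split.
  have -> : r * k * (v1 - u1) = r * ((E1 + k * v1) - (E1 + k * u1)) by ring.
  rewrite M1' M1.
  transitivity (r * (r * v1 + x' * s * v2) - y' * s * (r * v2 - x' * s * v1) + x' * y' * v1 * (1 - s ^+ 2)
    - (r * (r * u1 - y * s * u2) + x * s * (r * u2 + y * s * u1) + x * y * u1 * (1 - s ^+ 2))).
    by field.
  by rewrite -V1 -V2 ss; ring.
have -> : r * k * (v2 - u2) = r * ((E2 + k * v2) - (E2 + k * u2)) by ring.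
rewrite M2' M2.
transitivity (r * (r * v2 - x' * s * v1) + y' * s * (r * v1 + x' * s * v2) + x' * y' * v2 * (1 - s ^+ 2)
    - (r * (r * u2 + y * s * u1) - x * s * (r * u1 - y * s * u2) + x * y * u2 * (1 - s ^+ 2))).
  by field.
by rewrite -V1 -V2 ss; ring.
Qed.

End Metric.

(** * Bicentric polygons *)

Section Bicentric.
Context {R : realType}.

(** The centroid of the vertices works: heights are affine, so its height is the mean of those of
    the vertices, all nonnegative and one positive. *)
Lemma interior_point_exists n (A : 'I_n -> R * R) (s : R) : (0 < n)%N ->
  oriented_polygon A s -> exists C, forall j, 0 < edge_height A s j C.
Proof.
move=> n0 oA; exists (n%:R^-1 *: \sum_k A k) => j.
have nN0 : n%:R != 0 :> R by rewrite pnatr_eq0 -lt0n.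
have s1 : (\sum_k A k).1 = \sum_k (A k).1 by apply: (big_morph (fun P : R * R => P.1)).
have s2 : (\sum_k A k).2 = \sum_k (A k).2 by apply: (big_morph (fun P : R * R => P.2)).
have lin (a b c : R) : a * (n%:R^-1 * (\sum_k A k).1) + b * (n%:R^-1 * (\sum_k A k).2) + c =
    n%:R^-1 * \sum_k (a * (A k).1 + b * (A k).2 + c).
  rewrite !big_split/= -!mulr_sumr sumr_const card_ord s1 s2 -(mulr_natr c).
  by field.
have -> : edge_height A s j (n%:R^-1 *: \sum_k A k) =
    n%:R^-1 * \sum_k edge_height A s j (A k).
  rewrite /edge_height -mulr_sumr orient_lin !pairE lin mulrCA.
  by under [in RHS]eq_bigr do rewrite orient_lin.
rewrite mulr_gt0 ?invr_gt0 ?ltr0n// (bigD1 (ordS (ordS j)))//=.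
rewrite ltr_pwDl ?edge_height_next// sumr_ge0// => k _.
exact: edge_height_ge0.
Qed.

(** The incenter is the midpoint of two opposite points of the incircle, which lie in the convex
    region. *)
Lemma incircle_halfplanes n (A : 'I_n -> R * R) (s : R) I (r : R) : (0 < n)%N ->
  oriented_polygon A s -> incircle A I r -> halfplanes A s I.
Proof.
move=> n0 oA [r0 cI _].
have [C hC] := interior_point_exists n0 oA.
rewrite (regionE oA hC n0) in cI.
pose P : R * R := (I.1 - r, I.2); pose Q : R * R := (I.1 + r, I.2).
have -> : I = P + 2^-1 *: (Q - P).
  by rewrite [LHS]surjective_pairing [RHS]surjective_pairing !pairE/=; congr (_, _); field.
have dist t : t ^+ 2 = r ^+ 2 -> Defs.edist I (I.1 + t, I.2) = r.
  move=> tr; rewrite /Defs.edist/=.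
  have -> : (I.1 - (I.1 + t)) ^+ 2 + (I.2 - I.2) ^+ 2 = r ^+ 2 by rewrite -tr; ring.
  by rewrite sqrtr_sqr gtr0_norm.
by apply: halfplanes_seg; [apply: cI; apply: dist; rewrite sqrrN|apply: cI; apply: dist|lra].
Qed.

(** * The excenters in the frames of the sides *)

Section Assembly.
Context (n : nat) (A M : 'I_n -> R * R) (s : R) (I O : R * R) (r rO : R).
Hypotheses (n3 : (3 <= n)%N) (oA : oriented_polygon A s) (inI : incircle A I r).
Hypotheses (ccO : circumcircle A O rO) (exM : forall i, excenter A i (M i)).

Let n0 : (0 < n)%N. Proof. exact: leq_trans n3. Qed.
Let n1 : (1 < n)%N. Proof. exact: leq_trans n3. Qed.
Let ss : s ^+ 2 = 1.
Proof. by have [_ [->|->] _ _] := oA; rewrite ?sqrrN expr1n. Qed.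
Let r0 : 0 < r. Proof. by case: inI. Qed.

Let E := O + O - I.
Let k := (rO ^+ 2 - Defs.edist O I ^+ 2) / r.

Lemma side_frames_exist : exists u x y,
  forall i, side_frame s I r (A i) (A (ordS i)) (u i) (x i) (y i).
Proof.
suff /choice[f ff] : forall i, exists z : (R * R) * R * R,
    side_frame s I r (A i) (A (ordS i)) z.1.1 z.1.2 z.2.
  by exists (fun i => (f i).1.1), (fun i => (f i).1.2), (fun i => (f i).2).
move=> i.
have [u [x [y fi]]] : exists u x y, side_frame s I r (A i) (A (ordS i)) u x y.
  apply: side_frame_exists => //.
  - have [injA _ _ _] := oA.
    by apply: contraNneq (ordS_neq i n1) => /injA <-.
  - exact: (incircle_halfplanes n0 oA inI i).
  - by case: inI => _ _; exact.
by exists (u, x, y).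
Qed.

Section Frames.
Variables (u : 'I_n -> R * R) (x y : 'I_n -> R).
Hypothesis ff : forall i, side_frame s I r (A i) (A (ordS i)) (u i) (x i) (y i).

Let x0 i : 0 <= x i. Proof. by case: (ff i). Qed.
Let y0 i : 0 <= y i. Proof. by case: (ff i). Qed.
Let xy0 i : 0 < x i + y i. Proof. by case: (ff i). Qed.
Let uu i : (u i).1 ^+ 2 + (u i).2 ^+ 2 = 1. Proof. by case: (ff i). Qed.

Lemma height_frame i X : edge_height A s i X =
  (x i + y i) * (r - ((X.1 - I.1) * (u i).1 + (X.2 - I.2) * (u i).2)).
Proof. by rewrite /edge_height (side_frame_orient X ss (ff i)). Qed.

Lemma height_incenter i : edge_height A s i I = (x i + y i) * r.
Proof. by rewrite height_frame !subrr !mul0r addr0 subr0. Qed.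

Let hI i : 0 < edge_height A s i I.
Proof. by rewrite height_incenter mulr_gt0. Qed.

Lemma normals_cross i : 0 < s * ((u i).1 * (u (ordS i)).2 - (u i).2 * (u (ordS i)).1).
Proof.
apply: (side_frame_cross ss (ff i) (ff (ordS i))).
exact: edge_height_next oA i.
Qed.

(** Relative to the incenter, [reldist] depends on the side only through its normal. *)
Lemma normals_inj : injective u.
Proof.
move=> i j uij; apply: (reldist_inj oA hI) => X.
by rewrite /reldist !height_incenter !height_frame uij -!mulf_div !(divff (lt0r_neq0 (xy0 _))).
Qed.

Lemma excenter_frame i :
  M i = I + (r + x i * y i / r) *: u i + ((y i - x i) * s) *: rot90 (u i).
Proof.
have [rho [rho0 t1 t2 t3]] := exM i.
have e : ordS (ord_pred i) = i by exact: ord_predK.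
have fp : side_frame s I r (A (ord_pred i)) (A i) (u (ord_pred i)) (x (ord_pred i)) (y (ord_pred i)).
  by have := ff (ord_pred i); rewrite e.
apply: (excenterE ss r0 fp (ff i) (ff (ordS i)) _ _ rho0 t1 t2 t3).
- by have := normals_cross (ord_pred i); rewrite e.
- exact: normals_cross.
Qed.

Lemma excenter_homothetic i : M i = E + k *: u i.
Proof.
case: ccO => _ cc.
exact: (circumcenter_power ss r0 (ff i) (cc i) (cc (ordS i)) (excenter_frame i)).
Qed.

Lemma excenter_side i :
  r * k * ((u (ordS i)).1 - (u i).1) =
    - ((x i + y (ordS i)) * s * ((A (ordS i)).2 - I.2)) /\
  r * k * ((u (ordS i)).2 - (u i).2) =
    (x i + y (ordS i)) * s * ((A (ordS i)).1 - I.1).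
Proof.
have [_ _ _ _ [_ AE]] := ff i; have [_ _ _ _ [AE' _]] := ff (ordS i).
have -> : (A (ordS i)).1 - I.1 = r * (u i).1 - y i * s * (u i).2.
  by rewrite AE !pairE/=; ring.
have -> : (A (ordS i)).2 - I.2 = r * (u i).2 + y i * s * (u i).1.
  by rewrite AE !pairE/=; ring.
have e1 := etrans (esym (excenter_homothetic i)) (excenter_frame i).
have e2 := etrans (esym (excenter_homothetic (ordS i))) (excenter_frame (ordS i)).
apply: (@chord_excenters _ s r k (x i) (y i) (x (ordS i)) (y (ordS i)) _ _ _ _ E.1 E.2 I.1 I.2) => //.
- by rewrite gt_eqF.
- by have := congr1 fst AE; rewrite {1}AE' !pairE/=; lra.
- by have := congr1 snd AE; rewrite {1}AE' !pairE/=; lra.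
- by have := congr1 fst e1; rewrite !pairE/=; lra.
- by have := congr1 snd e1; rewrite !pairE/=; lra.
- by have := congr1 fst e2; rewrite !pairE/=; lra.
- by have := congr1 snd e2; rewrite !pairE/=; lra.
Qed.

Lemma vertex_normal i :
  ((A (ordS i)).1 - I.1) * (u i).1 + ((A (ordS i)).2 - I.2) * (u i).2 = r.
Proof.
have := edge_height_right A s i; rewrite height_frame => /eqP.
by rewrite mulf_eq0 gt_eqF//= subr_eq0 => /eqP.
Qed.

(** Multiplied by [k], this gives twice the area of the triangle on [M i], [M (ordS i)] with apex
    [E]. *)
Lemma excenter_cross i :
  k * (s * ((u i).1 * (u (ordS i)).2 - (u i).2 * (u (ordS i)).1)) =
  x i + y (ordS i).
Proof.
have [s1 s2] := excenter_side i.
apply: (mulfI (lt0r_neq0 r0)).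
transitivity (s * ((u i).1 * (r * k * ((u (ordS i)).2 - (u i).2)) -
  (u i).2 * (r * k * ((u (ordS i)).1 - (u i).1)))); first by ring.
rewrite s1 s2.
transitivity (s ^+ 2 * (x i + y (ordS i)) *
  (((A (ordS i)).1 - I.1) * (u i).1 + ((A (ordS i)).2 - I.2) * (u i).2)); first by ring.
by rewrite vertex_normal ss; ring.
Qed.

(** Were [k] nonpositive, all the nonnegative sums [x i + y (ordS i)] would vanish by
    [excenter_cross], and so would every tangent length. *)
Lemma homothety_ratio_gt0 : 0 < k.
Proof.
rewrite ltNge; apply/negP => k0.
have sum0 i : x i + y (ordS i) = 0.
  apply/eqP; rewrite eq_le addr_ge0// andbT -excenter_cross.
  by rewrite mulr_le0_ge0// ltW// normals_cross.
pose i := Ordinal n0.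
have e : ordS (ord_pred i) = i by exact: ord_predK.
have := sum0 i; have := sum0 (ord_pred i); rewrite e.
have := x0 i; have := y0 i; have := xy0 i; have := x0 (ord_pred i); have := y0 (ordS i).
lra.
Qed.

Lemma excenter_sides_gt0 i : 0 < x i + y (ordS i).
Proof. by rewrite -excenter_cross mulr_gt0 ?homothety_ratio_gt0 ?normals_cross. Qed.

(** A polarity: the line of side [i] of [M] is the scaled polar of [A (ordS i)]. For [X = u j] the
    last factor is, up to a positive factor, the height of [A (ordS i)] over side [j] of [A], so the
    convexity of [M] follows from that of [A]. *)
Lemma orient_excenters i X : r * (s * orient (M i) (M (ordS i)) (E + k *: X)) =
  k * (x i + y (ordS i)) *
  (r - (((A (ordS i)).1 - I.1) * X.1 + ((A (ordS i)).2 - I.2) * X.2)).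
Proof.
have [s1 s2] := excenter_side i.
rewrite !excenter_homothetic /orient !pairE.
transitivity (k * s * ((r * k * ((u (ordS i)).1 - (u i).1)) * (X.2 - (u i).2) -
  (r * k * ((u (ordS i)).2 - (u i).2)) * (X.1 - (u i).1))); first by ring.
rewrite s1 s2 -{1}(vertex_normal i).
transitivity (s ^+ 2 * k * (x i + y (ordS i)) * (((A (ordS i)).1 - I.1) * (u i).1 +
  ((A (ordS i)).2 - I.2) * (u i).2 -
  (((A (ordS i)).1 - I.1) * X.1 + ((A (ordS i)).2 - I.2) * X.2))); first by ring.
by rewrite ss mul1r.
Qed.

Let k0 := homothety_ratio_gt0.

Lemma oriented_excenters : oriented_polygon M s.
Proof.
have [_ s1 _ _] := oA; split => //.
- move=> i j; rewrite !excenter_homothetic => /addrI.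
  move=> /(congr1 (fun X => k^-1 *: X)); rewrite !scalerA mulVf ?gt_eqF// !scale1r.
  exact: normals_inj.
- move=> i j; rewrite -(pmulr_rge0 _ r0) (excenter_homothetic j) orient_excenters.
  rewrite pmulr_rge0; last by rewrite mulr_gt0 ?excenter_sides_gt0.
  by have := edge_height_ge0 oA j (ordS i); rewrite height_frame pmulr_rge0.
- move=> i; rewrite -(pmulr_rgt0 _ r0) (excenter_homothetic (ordS (ordS i))) orient_excenters.
  rewrite pmulr_rgt0; last by rewrite mulr_gt0 ?excenter_sides_gt0.
  by have := edge_height_prev oA (ordS i); rewrite height_frame pmulr_rgt0.
Qed.

Lemma height_excenters i : edge_height M s i E = k * (x i + y (ordS i)).
Proof.
apply: (mulfI (lt0r_neq0 r0)).
have := orient_excenters i 0; rewrite scaler0 addr0 => ->.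
by rewrite !mulr0 addr0 subr0 mulrC.
Qed.

Lemma area_frame : area A = r * (\sum_i (x i + y i)) / 2.
Proof.
rewrite (areaE oA hI n0) mulr_sumr mulr_suml; apply: eq_bigr => i _.
by rewrite height_incenter [r * _]mulrC.
Qed.

Lemma area_excenters_frame : area M = k * (\sum_i (x i + y i)) / 2.
Proof.
have hE i : 0 < edge_height M s i E.
  by rewrite height_excenters mulr_gt0 ?excenter_sides_gt0.
rewrite (areaE oriented_excenters hE n0).
under eq_bigr do rewrite height_excenters.
rewrite -mulr_suml -mulr_sumr !big_split/=; congr (_ * (_ + _) / _).
(* Summed cyclically, the shifted lengths [y (ordS i)] give the same total as the [y i]. *)
by rewrite [RHS](reindex_inj (can_inj (@ordSK n))).
Qed.

Lemma perimeter_gt0 : 0 < \sum_i (x i + y i).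
Proof.
by rewrite (bigD1 (Ordinal n0))//= ltr_pwDl// sumr_ge0// => i _; rewrite addr_ge0.
Qed.

(** If [Z] is the difference of the two centers, equidistance makes [Z] orthogonal to every side of
    [M], hence parallel to every vector from [I] to a vertex. Two adjacent vertices give independent
    directions, so [Z = 0]. *)
Lemma circumradius_excenters E' rE : circumcircle M E' rE -> rE = k.
Proof.
move=> [rE0 cM].
pose Z := E - E'.
have ZE i : 2 * k * (Z.1 * (u i).1 + Z.2 * (u i).2) =
    rE ^+ 2 - (Z.1 ^+ 2 + Z.2 ^+ 2) - k ^+ 2.
  rewrite -(cM i) edist_sqr excenter_homothetic !pairE.
  have -> : k ^+ 2 = k ^+ 2 * ((u i).1 ^+ 2 + (u i).2 ^+ 2) by rewrite uu mulr1.
  by rewrite /Z ?pairE; ring.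
have Zside i : ((A (ordS i)).1 - I.1) * Z.2 - ((A (ordS i)).2 - I.2) * Z.1 = 0.
  have [s1 s2] := excenter_side i.
  have e0 : Z.1 * ((u (ordS i)).1 - (u i).1) + Z.2 * ((u (ordS i)).2 - (u i).2) = 0.
    apply: (mulfI (lt0r_neq0 (mulr_gt0 (ltr0n _ 2) k0))).
    have := ZE i; have := ZE (ordS i); lra.
  have c0 : r * k * 0 = 0 :> R by rewrite mulr0.
  have xyN0 := lt0r_neq0 (excenter_sides_gt0 i).
  have sN0 : s != 0 by rewrite -sqrf_eq0 ss oner_eq0.
  apply: (mulfI (mulf_neq0 xyN0 sN0)); rewrite mulr0 -c0 -e0.
  transitivity (Z.1 * (- ((x i + y (ordS i)) * s * ((A (ordS i)).2 - I.2))) +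
    Z.2 * ((x i + y (ordS i)) * s * ((A (ordS i)).1 - I.1))); first by ring.
  by rewrite -s1 -s2; ring.
pose i := Ordinal n0; pose j := ordS i.
have D : orient (A j) (A (ordS j)) I != 0.
  by apply: contraTneq (hI j) => o; rewrite /edge_height o mulr0 ltxx.
have z1 := Zside i; have z2 := Zside j; rewrite -/j in z1.
have Z1 : Z.1 = 0.
  apply: (mulfI D); rewrite mulr0.
  transitivity (((A j).1 - I.1) * (((A (ordS j)).1 - I.1) * Z.2 - ((A (ordS j)).2 - I.2) * Z.1) * (-1)
    + ((A (ordS j)).1 - I.1) * (((A j).1 - I.1) * Z.2 - ((A j).2 - I.2) * Z.1)).
    by rewrite /orient; ring.
  by rewrite z1 z2; ring.
have Z2 : Z.2 = 0.
  apply: (mulfI D); rewrite mulr0.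
  transitivity (((A j).2 - I.2) * (((A (ordS j)).1 - I.1) * Z.2 - ((A (ordS j)).2 - I.2) * Z.1) * (-1)
    + ((A (ordS j)).2 - I.2) * (((A j).1 - I.1) * Z.2 - ((A j).2 - I.2) * Z.1)).
    by rewrite /orient; ring.
  by rewrite z1 z2; ring.
apply: sqr_inj_ge0; [exact: ltW|exact: ltW|].
by have := ZE i; rewrite Z1 Z2; lra.
Qed.

End Frames.
End Assembly.
End Bicentric.

Theorem theorem2 (R : realType) (n : nat) (A M : 'I_n -> R * R)
    (I E : R * R) (rC rE : R) :
  (3 <= n)%N ->
  bicentric A ->
  incircle A I rC ->
  (forall i : 'I_n, excenter A i (M i)) ->
  circumcircle M E rE ->
  area A / area M = rC / rE.
Proof.
move=> n3 [cvA [Q [rO ccQ]] _] inI exM ccM.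
have [s oA] := convex_oriented n3 cvA.
have [u [x [y ff]]] := side_frames_exist n3 oA inI.
rewrite (area_frame n3 oA inI ff) (area_excenters_frame n3 oA inI ccQ exM ff).
rewrite (circumradius_excenters n3 oA inI ccQ exM ff ccM).
have := homothety_ratio_gt0 n3 oA inI ccQ exM ff.
have := perimeter_gt0 n3 ff.
(* Only the perimeter [S] and the radius [k] remain, both positive, and [S / 2] cancels. *)
move: (\sum_i _) (_ / rC) => S k S0 k0.
by field; rewrite !gt_eqF.
Qed.
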